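(* Let $n>2$ and $\lambda\neq 0$. Up to periodic null mode coefficients, there are no central quantum-symmetric metrics $$g=\sum_{i,j}a_{ij}\,\mathrm dx_i\otimes \mathrm dx_j+\sum_i b_i(\mathrm dx_i\otimes \mathrm dt+\mathrm dt\otimes \mathrm dx_i)+c\,\mathrm dt\otimes \mathrm dt\in\Omega^1\otimes_A\Omega^1,\qquad a_{ij}=a_{ji},\quad a_{ij},b_i,c\in A,$$ other than the degenerate case $$g_{deg}=\sum_{i,j}a_{ij}\,\mathrm dx_i\otimes \mathrm dx_j$$ with $a_{ij}$ of scaling degree $0$.
   Context: $\lambda$ is an imaginary parameter. $A$ is the algebra with generators $x_1,\dots,x_{n-1},t$ and relations $[x_i,x_j]=0$, $[x_i,t]=\lambda x_i$. A general element of $A$ is thought of as a normal-ordered function $f(x,t)$, with $t$ to the right, where $x=(x_1,\dots,x_{n-1})$. The class of functions is not specified further. The relations imply $$[f(x),t]=\lambda\sum_i x_i\frac{\partial f}{\partial x_i},\qquad [h(t),x_i]=x_i\big(h(t-\lambda)-h(t)\big)$$ for functions $f$ of $x$ and $h$ of $t$. Periodic null modes are the nonconstant functions $h(t)$ with $h(t-\lambda)=h(t)$, such as $e^{2\pi \imath m t/\lambda}$ with $m$ a nonzero integer. They have no limit as $\lambda\to0$. ''Up to periodic null mode coefficients'' means that such modes are excluded from the coefficients of $g$, so that an element commuting with some $x_k$ is taken to be a function of $x$ alone. (For example, there are no such modes if one limits oneself to rational functions of $t$.) $\Omega^1$ is the $A$-bimodule of 1-forms, with basis $\mathrm dx_1,\dots,\mathrm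 dx_{n-1},\mathrm dt$ over $A$ and relations $$[\mathrm dx_i,x_j]=0,\quad [\mathrm dx_i,t]=0,\quad [x_i,\mathrm dt]=\lambda\,\mathrm dx_i,\quad [t,\mathrm dt]=\lambda\,\mathrm dt .$$ Central means commuting with all elements of $A$. Quantum-symmetric means $\wedge(g)=0$, where $\mathrm dx_i,\mathrm dt$ mutually anticommute and square to zero in the exterior algebra; this is the displayed symmetric form of $g$. Scaling degree $0$ means that $a_{ij}$ is a function of $x$ alone with $\sum_k x_k\,\partial a_{ij}/\partial x_k=0$. *)

(* Defs.v *)
From HB Require Import structures.
From mathcomp Require Import all_boot all_order all_algebra.
From mathcomp Require Import reals complex.

Set Implicit Arguments.
Unset Strict Implicit.
Unset Printing Implicit Defensive.

Import GRing.Theory.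
Local Open Scope ring_scope.

(* Bimodules over a K-algebra A.  The left action is the scaling [*:]; the
   two induced actions of K agree. *)
Record bimodule (K : fieldType) (A : algType K) := Bimodule {
  bimod_sort :> lmodType A;
  ract : bimod_sort -> A -> bimod_sort;
  ractDl : forall m m' a, ract (m + m') a = ract m a + ract m' a;
  ractDr : forall m a b, ract m (a + b) = ract m a + ract m b;
  ract1 : forall m, ract m 1 = m;
  ractM : forall m a b, ract m (a * b) = ract (ract m a) b;
  ractZ : forall a m b, ract (a *: m) b = a *: ract m b;
  ractK : forall m (k : K), ract m k%:A = k%:A *: m
}.

Notation "m *r a" := (ract m a) (at level 40, left associativity).

Definition central (K : fieldType) (A : algType K) (M : bimodule A) (m : M) :=
  forall a : A, a *: m = m *r a.

Definition left_basis (A : nzRingType) (M : lmodType A) (I : finType)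
    (e : I -> M) :=
  forall m : M, exists! c : {ffun I -> A}, m = \sum_i c i *: e i.

Definition balanced (K : fieldType) (A : algType K) (M N : bimodule A)
    (G : zmodType) (beta : M -> N -> G) :=
  [/\ forall m m' n, beta (m + m') n = beta m n + beta m' n,
      forall m n n', beta m (n + n') = beta m n + beta m n'
    & forall m a n, beta (m *r a) n = beta m (a *: n)].

(* (P, tens) is the tensor product of M and N over A, by its universal
   property, with the outer bimodule structure. *)
Definition is_tensor_product (K : fieldType) (A : algType K)
    (M N P : bimodule A) (tens : M -> N -> P) :=
  [/\ balanced tens,
      forall a m n, tens (a *: m) n = a *: tens m n,
      forall m n a, tens m (n *r a) = tens m n *r a
    & forall (G : zmodType) (beta : M -> N -> G), balanced beta ->
        exists phi : {additive P -> G},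
          (forall m n, phi (tens m n) = beta m n) /\
          forall psi : {additive P -> G},
            (forall m n, psi (tens m n) = beta m n) -> psi =1 phi].

(* The algebra A with generators x_1, ..., x_m, t (m = n - 1), for an
   unspecified class of functions; its elements are thought of as
   normal-ordered functions f(x,t), with t to the right.
   - [xfun] is the commutative algebra of functions of x alone, with its
     partial derivatives [pder]; [xinj] is its inclusion in A.
   - [shift] is f(x,t) |-> f(x,t - lam).  The identity [shiftP] reads
     [f, x_i] = x_i (f(x,t - lam) - f(x,t)); for f = h(t) it is the usual
     relation, and functions of x commute with x_i.
   - [x_reg] holds since x_i f(x,t) is a pointwise product.
   - [A_gen] is what it means for x_i and t to generate A when the functions
     are not only polynomials: an element that commutes with the generators
     commutes with every element. *)
Record spacetime (K : fieldType) (m : nat) (lam : K) := Spacetime {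
  alg :> algType K;
  xfun : comAlgType K;
  xinj : {lrmorphism xfun -> alg};
  xinj_inj : injective xinj;
  X : 'I_m -> xfun;
  pder : 'I_m -> {linear xfun -> xfun};
  pderM : forall i f g, pder i (f * g) = pder i f * g + f * pder i g;
  pderX : forall i j, pder i (X j) = (i == j)%:R;
  t : alg;
  xt_comm : forall f : xfun,
    xinj f * t - t * xinj f = lam *: xinj (\sum_i X i * pder i f);
  shift : {lrmorphism alg -> alg};
  shift_xinj : forall f : xfun, shift (xinj f) = xinj f;
  shift_t : shift t = t - lam%:A;
  shiftP : forall (a : alg) i,
    a * xinj (X i) - xinj (X i) * a = xinj (X i) * (shift a - a);
  x_reg : forall (a : alg) i, xinj (X i) * a = 0 -> a = 0;
  A_gen : forall a : alg,
    (forall i, xinj (X i) * a = a * xinj (X i)) -> t * a = a * t ->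
    forall b : alg, b * a = a * b
}.

Definition x (K : fieldType) (m : nat) (lam : K) (A : spacetime m lam)
  (i : 'I_m) : A := xinj A (X A i).

Definition function_of_x (K : fieldType) (m : nat) (lam : K)
    (A : spacetime m lam) (a : A) := exists f : xfun A, a = xinj A f.

(* a(x,t) is not a periodic null mode, possibly with coefficients depending
   on x: if a(x,t - lam) = a(x,t), then a does not depend on t. *)
Definition null_mode_free (K : fieldType) (m : nat) (lam : K)
    (A : spacetime m lam) (a : A) := shift A a = a -> function_of_x a.

Definition scaling_degree0 (K : fieldType) (m : nat) (lam : K)
    (A : spacetime m lam) (a : A) :=
  exists f : xfun A, a = xinj A f /\ \sum_k X A k * pder A k f = 0.

Definition basis1 (T : Type) (m : nat) (dx : 'I_m -> T) (dt : T)
    (k : 'I_m + unit) : T :=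
  match k with inl i => dx i | inr _ => dt end.

(* dx_i ^ dx_j for i < j, and dx_i ^ dt, from the products [xx] and [xt] *)
Definition basis2 (T : Type) (m : nat) (xx : 'I_m -> 'I_m -> T)
    (xt : 'I_m -> T) (k : {p : 'I_m * 'I_m | (p.1 < p.2)%N} + 'I_m) : T :=
  match k with inl p => xx (val p).1 (val p).2 | inr i => xt i end.

(* [Om11] is the tensor square of Om1 over A and [wedge : Om11 -> Om2] the
   product of the exterior algebra in degree 2.  [Om1_gen] has the same role
   as [A_gen]; the bimodule relations are given on generators. *)
Record calculus (K : fieldType) (m : nat) (lam : K) (A : spacetime m lam) :=
Calculus {
  Om1 : bimodule A;
  dx : 'I_m -> Om1;
  dt : Om1;
  Om1_basis : left_basis (basis1 dx dt);
  dx_x : forall i j, dx i *r x A j - x A j *: dx i = 0;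
  dx_t : forall i, dx i *r t A - t A *: dx i = 0;
  x_dt : forall i, x A i *: dt - dt *r x A i = lam%:A *: dx i;
  t_dt : t A *: dt - dt *r t A = lam%:A *: dt;
  Om1_gen : forall w : Om1,
    (forall i, x A i *: w = w *r x A i) -> t A *: w = w *r t A -> central w;
  Om11 : bimodule A;
  tens : Om1 -> Om1 -> Om11;
  tensP : is_tensor_product tens;
  Om2 : bimodule A;
  wedge : {linear Om11 -> Om2};
  wedge_ract : forall w (a : A), wedge (w *r a) = wedge w *r a;
  dx_dx : forall i j,
    wedge (tens (dx i) (dx j)) = - wedge (tens (dx j) (dx i));
  dx_dt : forall i, wedge (tens (dx i) dt) = - wedge (tens dt (dx i));
  dx_sq : forall i, wedge (tens (dx i) (dx i)) = 0;
  dt_sq : wedge (tens dt dt) = 0;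
  Om2_basis : left_basis
    (basis2 (fun i j => wedge (tens (dx i) (dx j)))
            (fun i => wedge (tens (dx i) dt)))
}.

Definition quantum_symmetric (K : fieldType) (m : nat) (lam : K)
    (A : spacetime m lam) (D : calculus A) (g : Om11 D) := wedge D g = 0.

Definition g_deg (K : fieldType) (m : nat) (lam : K) (A : spacetime m lam)
    (D : calculus A) (a : 'I_m -> 'I_m -> A) : Om11 D :=
  \sum_i \sum_j a i j *: tens (dx D i) (dx D j).

Definition metric (K : fieldType) (m : nat) (lam : K) (A : spacetime m lam)
    (D : calculus A) (a : 'I_m -> 'I_m -> A) (b : 'I_m -> A) (c : A) :
    Om11 D :=
  \sum_i \sum_j a i j *: tens (dx D i) (dx D j)
  + \sum_i b i *: (tens (dx D i) (dt D) + tens (dt D) (dx D i))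
  + c *: tens (dt D) (dt D).

(* Main.v *)
(** Comparing the coefficients of [x_k g = g x_k] on the basis of the tensor
    square gives [[c, x_k] = 0], [[b_i, x_k] = lam delta_ik c] and
    [[a_ij, x_k] = lam (delta_jk b_i + delta_ik b_j)].  By the relation
    [[f, x_k] = x_k (f(x, t - lam) - f(x, t))], whether [f] commutes with [x_k]
    does not depend on [k].  As there are at least two variables [x_k], some
    [k <> i] shows that [b_i] commutes with [x_k], hence with [x_i], so that
    [c = 0]; the same argument for [a_ii] then gives [b_i = 0].  What is left
    of [g] is [sum a_ij dx_i (x) dx_j] with [a_ij] a function of [x], and
    commuting with [t] says that [a_ij] has scaling degree 0. *)

Require Import Defs.
From mathcomp Require Import all_boot all_order all_algebra.
From mathcomp Require Import reals complex.
Set Implicit Arguments.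
Unset Strict Implicit.
Unset Printing Implicit Defensive.
Import GRing.Theory.
Local Open Scope ring_scope.

(** * Coordinates on left bases and on tensor products of bimodules *)

Section Bimodules.
Variables (K : fieldType) (A : algType K).
Implicit Types M N P : bimodule A.

Lemma ract0l M (a : A) : (0 : M) *r a = 0.
Proof. by apply: (addrI (0 *r a)); rewrite -ractDl !addr0. Qed.

Lemma ract_suml M (I : finType) (F : I -> M) (a : A) :
  (\sum_i F i) *r a = \sum_i F i *r a.
Proof.
exact: (big_morph (fun m : M => m *r a) (fun m n => ractDl m n a) (ract0l M a)).
Qed.

Section LeftBasis.
Variables (M : bimodule A) (I : finType) (e : I -> M).
Hypothesis e_basis : left_basis e.

(** Boolean equality makes the predicate decidable, as [xchoose] requires. *)
Fact left_basis_coord (m : M) :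
  exists c : {ffun I -> A}, m == \sum_i c i *: e i.
Proof. by have [c [/eqP ec _]] := e_basis m; exists c. Qed.

Definition coord (m : M) := xchoose (left_basis_coord m).

Lemma coordP (m : M) : m = \sum_i coord m i *: e i.
Proof. by apply/eqP; exact: xchooseP (left_basis_coord m). Qed.

Lemma coord_unique (m : M) (c : I -> A) :
  m = \sum_i c i *: e i -> forall i, coord m i = c i.
Proof.
move=> mE i; have [d [_ d_uniq]] := e_basis m.
have -> : coord m = [ffun i => c i].
  rewrite -(d_uniq (coord m)) ?(d_uniq [ffun i => c i]) //; last exact: coordP.
  by rewrite mE; apply: eq_bigr => j _; rewrite ffunE.
by rewrite ffunE.
Qed.

Lemma coordD (m n : M) i : coord (m + n) i = coord m i + coord n i.
Proof.
apply: (coord_unique (c := fun i => coord m i + coord n i)).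
rewrite {1}(coordP m) {1}(coordP n) -big_split.
by apply: eq_bigr => j _; rewrite scalerDl.
Qed.

Lemma coordZ (a : A) (m : M) i : coord (a *: m) i = a * coord m i.
Proof.
apply: (coord_unique (c := fun i => a * coord m i)).
rewrite {1}(coordP m) scaler_sumr.
by apply: eq_bigr => j _; rewrite scalerA.
Qed.

Lemma coord_basis i j : coord (e j) i = (i == j)%:R.
Proof.
apply: (coord_unique (c := fun i => (i == j)%:R)).
rewrite (bigD1 j) //= eqxx scale1r big1 ?addr0 // => k /negPf ->.
by rewrite scale0r.
Qed.

End LeftBasis.

(** Expanding the right factor [n] in [f] and moving its coordinates across the tensor sign, the
    coordinate on [e k] and [f l] must be that of [m *r coord f_basis n l] on [e k]. This is
    balanced because coordinates are left linear, so the universal property provides the functional.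
    It shows that products of basis elements are left independent. *)
Lemma tensor_coord M N P (tens : M -> N -> P) (I J : finType)
    (e : I -> M) (f : J -> N) (e_basis : left_basis e) (f_basis : left_basis f)
    (k : I) (l : J) : is_tensor_product tens ->
  exists phi : {additive P -> A}, forall (a : A) i j,
    phi (a *: tens (e i) (f j)) = if (i == k) && (j == l) then a else 0.
Proof.
move=> [_ tensZ _ univ].
pose beta m n := coord e_basis (m *r coord f_basis n l) k.
have beta_bal : balanced (G := A) beta.
  split=> [m m' n|m n n'|m a n]; rewrite /beta.
  - by rewrite ractDl coordD.
  - by rewrite coordD ractDr coordD.
  - by rewrite coordZ ractM.
have [phi [phiE _]] := univ _ beta beta_bal.
exists phi => a i j; rewrite -tensZ phiE /beta coord_basis.
rewrite (eq_sym i) (eq_sym j); case: (l == j); rewrite ?andbT ?andbF.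
  by rewrite ract1 coordZ coord_basis; case: (k == i); rewrite ?mulr1 ?mulr0.
have -> (m : M) : m *r 0 = 0.
  by apply: (addrI (m *r 0)); rewrite -ractDr !addr0.
by rewrite -(scale0r (e i)) coordZ mul0r.
Qed.

End Bimodules.

(** * Commutation with the generators of the algebra *)

Section Spacetime.
Variables (K : fieldType) (m : nat) (lam : K) (A : spacetime m lam).
Hypothesis lam0 : lam != 0.

(** The commutator is [x A i] times [shift A a - a], and [x A i] can be cancelled on the left. The
    index [i] is absent from the right-hand side, so commuting with one variable amounts to
    commuting with all of them. *)
Lemma commute_x_shift (a : A) i : a * x A i = x A i * a <-> shift A a = a.
Proof.
have := shiftP a i; rewrite -/(x A i) => aE; split=> [ax|sa].
  apply/eqP; rewrite -subr_eq0; apply/eqP/(x_reg (i := i)).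
  by rewrite -/(x A i) -aE ax subrr.
by apply/eqP; rewrite -subr_eq0 aE sa subrr mulr0.
Qed.

Lemma commute_t_xinj (f : xfun A) :
  xinj A f * t A = t A * xinj A f <-> \sum_k X A k * pder A k f = 0.
Proof.
have fE := xt_comm f; split=> [ft|f0].
  apply: (@xinj_inj _ _ _ A); rewrite rmorph0.
  apply: (can_inj (scalerK lam0)); rewrite scaler0.
  by rewrite -fE ft subrr.
by apply/eqP; rewrite -subr_eq0 fE f0 rmorph0 scaler0.
Qed.

Lemma scaling_degree0_central (a b : A) :
  scaling_degree0 a -> b * a = a * b.
Proof.
move=> [f [-> f0]]; apply: A_gen => [i|].
  by rewrite -!rmorphM mulrC.
by have [_ ->] := commute_t_xinj f.
Qed.

(** * Commutation of forms and their tensor products with the algebra *)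

Variable D : calculus A.

Lemma dx_central i : central (dx D i).
Proof.
apply: Om1_gen => [j|]; apply/esym/eqP; rewrite -subr_eq0; apply/eqP.
  exact: dx_x.
exact: dx_t.
Qed.

Lemma dt_x i : dt D *r x A i = x A i *: dt D - lam%:A *: dx D i.
Proof. by rewrite -x_dt opprB addrC subrK. Qed.

Lemma tensDr w (u v : Om1 D) : tens w (u + v) = tens w u + tens w v.
Proof. by have [[_ ->]] := tensP D. Qed.

Lemma tensDl w (u v : Om1 D) : tens (u + v) w = tens u w + tens v w.
Proof. by have [[->]] := tensP D. Qed.

Lemma tensZl a (u v : Om1 D) : tens (a *: u) v = a *: tens u v.
Proof. by have [_ ->] := tensP D. Qed.

Lemma tens_ract a (u v : Om1 D) : tens u (v *r a) = tens u v *r a.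
Proof. by have [_ _ ->] := tensP D. Qed.

Lemma tens_bal a (u v : Om1 D) : tens u (a *: v) = tens (u *r a) v.
Proof. by have [[_ _ ->]] := tensP D. Qed.

Lemma dx_dx_central i j : central (tens (dx D i) (dx D j)).
Proof.
by move=> a; rewrite -tens_ract -dx_central tens_bal -dx_central tensZl.
Qed.

Lemma dx_dt_x i k : tens (dx D i) (dt D) *r x A k =
  x A k *: tens (dx D i) (dt D) - lam%:A *: tens (dx D i) (dx D k).
Proof.
rewrite -tens_ract dt_x -scaleNr tensDr !tens_bal -!dx_central.
by rewrite !tensZl scaleNr.
Qed.

Lemma dt_dx_x i k : tens (dt D) (dx D i) *r x A k =
  x A k *: tens (dt D) (dx D i) - lam%:A *: tens (dx D k) (dx D i).
Proof.
by rewrite -tens_ract -dx_central tens_bal dt_x -!scaleNr tensDl !tensZl.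
Qed.

Lemma dt_dt_x k : tens (dt D) (dt D) *r x A k =
  x A k *: tens (dt D) (dt D) - lam%:A *: tens (dx D k) (dt D)
  - lam%:A *: tens (dt D) (dx D k).
Proof.
rewrite -tens_ract dt_x -!scaleNr tensDr !tens_bal.
(* Although [dt] is not central, scalars of [K] act on it alike from both sides, by [ractK]. *)
by rewrite dt_x ractK -!scaleNr tensDl !tensZl.
Qed.


(** * Coefficients of a metric and their change under right multiplication *)

Definition metric_coef (a : 'I_m -> 'I_m -> A) (b : 'I_m -> A) (c : A)
    (k l : 'I_m + unit) : A :=
  match k, l with
  | inl i, inl j => a i j
  | inl i, inr _ => b i
  | inr _, inl j => b j
  | inr _, inr _ => c
  end.

Lemma metric_coord k l : exists phi : {additive Om11 D -> A}, forall a b c,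
  phi (metric D a b c) = metric_coef a b c k l.
Proof.
have e_basis := Om1_basis (c := D).
have [phi phiE] := tensor_coord e_basis e_basis k l (tensP D).
exists phi => a b c.
have phixx s i j := phiE s (inl i) (inl j).
have phixt s i := phiE s (inl i) (inr tt).
have phitx s i := phiE s (inr tt) (inl i).
have phitt s := phiE s (inr tt) (inr tt).
have sumE1 i (F : 'I_m -> A) : \sum_j (if j == i then F j else 0) = F i.
  by rewrite -big_mkcond big_pred1_eq.
have phixt0 i : phi (b i *: (tens (dx D i) (dt D) + tens (dt D) (dx D i))) =
    (if (inl i == k) && (inr tt == l) then b i else 0)
    + (if (inr tt == k) && (inl i == l) then b i else 0).
  by rewrite scalerDr raddfD /= phixt phitx.
rewrite /metric !raddfD !raddf_sum /= phitt.
under eq_bigr => i _ do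
  (rewrite raddf_sum; under eq_bigr => j _ do rewrite phixx).
under [X in _ + X + _]eq_bigr => i _ do rewrite phixt0.
have inlE i j : ((inl i : 'I_m + unit) == inl j) = (i == j) by [].
have inlrE i u : ((inl i : 'I_m + unit) == inr u) = false by [].
have inrE u v : ((inr u : 'I_m + unit) == inr v) by case: u v => [] [].
(* One case for each block of the coefficient matrix; in each, the tests on indices kill the other
   blocks and leave a single term. *)
case: k l {phi phiE phixx phixt phitx phitt phixt0} => [i|u] [j|v] /=;
  under eq_bigr => p _ do
    under eq_bigr => q _ do rewrite ?inlE ?inlrE ?andbF //=.
- rewrite (eq_bigr (fun p => if p == i then a p j else 0)); last first.
    by move=> p _; case: (p == i); rewrite ?sumE1 ?big1.
  rewrite sumE1 big1 ?addr0 // => p _.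
  by rewrite /= andbF addr0.
- rewrite big1 ?add0r; last by move=> p _; rewrite big1.
  rewrite addr0 -[RHS](sumE1 i b); apply: eq_bigr => p _.
  by rewrite inlE inrE andbT addr0.
- rewrite big1 ?add0r; last by move=> p _; rewrite big1.
  rewrite addr0 -[RHS](sumE1 j b); apply: eq_bigr => p _.
  by rewrite inlE add0r.
- rewrite big1 ?add0r; last by move=> p _; rewrite big1.
  by rewrite big1 ?add0r // => p _; rewrite addr0.
Qed.

Lemma metric_inj a b c a' b' c' : metric D a b c = metric D a' b' c' ->
  [/\ forall i j, a i j = a' i j, forall i, b i = b' i & c = c'].
Proof.
move=> gg'; have E k l : metric_coef a b c k l = metric_coef a' b' c' k l.
  by have [phi phiE] := metric_coord k l; rewrite -!phiE gg'.
split=> [i j|i|]; first exact: (E (inl i) (inl j)).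
  exact: (E (inl i) (inr tt)).
exact: (E (inr tt) (inr tt)).
Qed.

Lemma metricZ (s : A) a b c : s *: metric D a b c =
  metric D (fun i j => s * a i j) (fun i => s * b i) (s * c).
Proof.
rewrite /metric !scalerDr !scaler_sumr scalerA; congr (_ + _ + _).
  apply: eq_bigr => i _; rewrite scaler_sumr.
  by apply: eq_bigr => j _; rewrite scalerA.
by apply: eq_bigr => i _; rewrite scalerA.
Qed.

(** Moving [x A k] to the left past a factor [dt] replaces that factor by [- lam dx_k] in a
    correction term. Hence [c] feeds into the coefficients of index [k] in [b], and [b] into row and
    column [k] of [a]. The result again has the shape of a metric, so that [metric_inj] applies to
    it. *)
Lemma metric_x a b c k : metric D a b c *r x A k =
  metric D
    (fun i j => a i j * x A k
                - lam *: ((j == k)%:R * b i + (i == k)%:R * b j))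
    (fun i => b i * x A k - lam *: ((i == k)%:R * c))
    (c * x A k).
Proof.
have scaleC (s : A) (v : Om11 D) : s *: (lam%:A *: v) = (lam *: s) *: v.
  by rewrite scalerA -scalerAr mulr1.
have sum1 (V : lmodType A) (F : 'I_m -> A) (G : 'I_m -> V) :
    \sum_i (lam *: ((i == k)%:R * F i)) *: G i = (lam *: F k) *: G k.
  rewrite (bigD1 k) //= eqxx mul1r big1 ?addr0 // => i /negPf ->.
  by rewrite mul0r scaler0 scale0r.
rewrite /metric !ractDl !ract_suml.
under eq_bigr => i _ do
  (rewrite ract_suml;
   under eq_bigr => j _ do rewrite ractZ -dx_dx_central scalerA).
under [X in _ + X + _]eq_bigr => i _ do
  rewrite ractZ ractDl dx_dt_x dt_dx_x addrACA -scalerDr -opprD -scalerDr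
          scalerBr scalerA scaleC [X in _ - X]scalerDr.
rewrite sumrB big_split /= ractZ dt_dt_x.
rewrite -[X in c *: X]addrA -opprD -scalerDr scalerBr scalerA scaleC.
have -> : \sum_i \sum_j (a i j * x A k
      - lam *: ((j == k)%:R * b i + (i == k)%:R * b j))
      *: tens (dx D i) (dx D j) =
    \sum_i \sum_j (a i j * x A k) *: tens (dx D i) (dx D j)
    - (\sum_i (lam *: b i) *: tens (dx D i) (dx D k)
       + \sum_j (lam *: b j) *: tens (dx D k) (dx D j)).
  (* The two Kronecker deltas collapse different sums: [j == k] the inner one, [i == k] the outer
     one after an exchange. *)
  transitivity (\sum_i ((\sum_j (a i j * x A k) *: tens (dx D i) (dx D j))
    - ((lam *: b i) *: tens (dx D i) (dx D k)
       + \sum_j (lam *: ((i == k)%:R * b j)) *: tens (dx D i) (dx D j))));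
    last first.
    rewrite sumrB big_split /= [X in _ - (_ + X)]exchange_big /=.
    congr (_ - (_ + _)); apply: eq_bigr => j _.
    exact: (sum1 _ (fun=> b j) (fun i => tens (dx D i) (dx D j))).
  apply: eq_bigr => i _.
  rewrite -(sum1 _ (fun=> b i) (fun j => tens (dx D i) (dx D j))).
  rewrite -big_split -sumrB.
  by apply: eq_bigr => j _; rewrite scalerBl scalerDr scalerDl.
have -> : \sum_i (b i * x A k - lam *: ((i == k)%:R * c))
      *: (tens (dx D i) (dt D) + tens (dt D) (dx D i)) =
    \sum_i (b i * x A k) *: (tens (dx D i) (dt D) + tens (dt D) (dx D i))
    - (lam *: c) *: (tens (dx D k) (dt D) + tens (dt D) (dx D k)).
  rewrite -(sum1 _ (fun=> c)
    (fun i => tens (dx D i) (dt D) + tens (dt D) (dx D i))) -sumrB.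
  by apply: eq_bigr => i _; rewrite scalerBl.
rewrite -!addrA; congr (_ + _).
rewrite [RHS]addrCA; congr (_ + (_ + _)).
by rewrite addrC.
Qed.

(** * Centrality and symmetry of metrics *)

Lemma metric_central_x a b c k :
  x A k *: metric D a b c = metric D a b c *r x A k ->
  [/\ c * x A k = x A k * c,
      forall i, b i * x A k - x A k * b i = lam *: ((i == k)%:R * c)
    & forall i j, a i j * x A k - x A k * a i j =
        lam *: ((j == k)%:R * b i + (i == k)%:R * b j)].
Proof.
rewrite metricZ metric_x => /metric_inj[aE bE cE].
by split=> // [i|i j]; rewrite ?bE ?aE opprB addrC subrK.
Qed.

Lemma g_deg_central a : (forall i j, scaling_degree0 (a i j)) ->
  central (g_deg D a).
Proof.
move=> a0 s; rewrite /g_deg scaler_sumr ract_suml; apply: eq_bigr => i _.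
rewrite scaler_sumr ract_suml; apply: eq_bigr => j _.
by rewrite ractZ -dx_dx_central !scalerA scaling_degree0_central.
Qed.

Lemma metric_deg a : metric D a (fun=> 0) 0 = g_deg D a.
Proof.
rewrite /metric scale0r addr0 [X in _ + X]big1 ?addr0 // => i _.
exact: scale0r.
Qed.

(** Exchanging the two indices fixes [a] and negates the wedge products, so the image under [wedge]
    equals its opposite; then 2 is inverted. *)
Lemma g_deg_symmetric a : 2%:R != 0 :> K -> (forall i j, a i j = a j i) ->
  quantum_symmetric (g_deg D a).
Proof.
move=> two0 aS; rewrite /quantum_symmetric /g_deg.
set w := wedge D _.
have wE : w = \sum_i \sum_j a i j *: wedge D (tens (dx D i) (dx D j)).
  rewrite /w linear_sum; apply: eq_bigr => i _; rewrite linear_sum.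
  by apply: eq_bigr => j _; rewrite linearZ_LR.
have wN : w = - w.
  rewrite {1}wE exchange_big wE -sumrN; apply: eq_bigr => i _.
  by rewrite -sumrN; apply: eq_bigr => j _; rewrite aS dx_dx scalerN.
have : (2%:R : K)%:A *: w = 0.
  by rewrite scaler_nat mulr2n scalerDl scale1r {2}wN subrr.
move/(congr1 (fun v => (2%:R^-1 : K)%:A *: v)).
by rewrite scalerA -scalerAl mul1r scalerA mulVf // !scale1r scaler0.
Qed.

Lemma central_metric_deg a b c : 2%:R != 0 :> K -> (1 < m)%N ->
  (forall i j, null_mode_free (a i j)) -> central (metric D a b c) ->
  metric D a b c = g_deg D a /\ forall i j, scaling_degree0 (a i j).
Proof.
move=> two0 m1 a_free g_central.
have gx k := metric_central_x (g_central (x A k)).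
have other (i : 'I_m) : exists k, i != k.
  pose k0 := Ordinal (ltnW m1); pose k1 := Ordinal m1.
  have [->|k0i] := eqVneq i k0; first by exists k1.
  by exists k0.
(* Both sides are equivalent to invariance under the shift. *)
have transfer f i k : f * x A k = x A k * f -> f * x A i = x A i * f.
  by move=> /commute_x_shift/(commute_x_shift f i).
have lam_inj (f : A) : lam *: f = 0 -> f = 0.
  by move=> lf; apply: (can_inj (scalerK lam0)); rewrite lf scaler0.
have c0 : c = 0.
  pose i := Ordinal m1; have [k /negPf ik] := other i.
  have [_ bk _] := gx k; have [_ bi _] := gx i.
  have bix : b i * x A i = x A i * b i.
    apply: (transfer _ _ k); apply/eqP; rewrite -subr_eq0 bk.
    by rewrite ik mul0r scaler0.
  by apply: lam_inj; rewrite -[c]mul1r -(bi i) ?eqxx bix subrr.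
have b0 i : b i = 0.
  have [k /negPf ik] := other i.
  have [_ _ ak] := gx k; have [_ _ ai] := gx i.
  have aix : a i i * x A i = x A i * a i i.
    apply: (transfer _ _ k); apply/eqP; rewrite -subr_eq0 ak.
    by rewrite ik !mul0r addr0 scaler0.
  (* For [k = i] both deltas are 1, so the relation reads [lam (b_i + b_i) = 0]; the factor 2 must
     be cancelled as well as [lam]. *)
  have /esym := ai i i; rewrite aix subrr eqxx mul1r => /lam_inj.
  rewrite -mulr2n -scaler_nat => b20.
  by apply: (can_inj (scalerK two0)); rewrite b20 scaler0.
have gE : metric D a b c = g_deg D a.
  rewrite -metric_deg c0 /metric; congr (_ + _ + _).
  by apply: eq_bigr => i _; rewrite b0.
split=> // i j.
have [f aE] : function_of_x (a i j).
  (* With [b = 0], [a i j] commutes with the variables, hence is invariant under the shift; the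
     exclusion of null modes makes it a function of [x]. *)
  apply: a_free; apply/(commute_x_shift _ i).
  have [_ _ ai] := gx i; apply/eqP; rewrite -subr_eq0 ai.
  by rewrite !b0 !mulr0 addr0 scaler0.
exists f; split=> //; apply/commute_t_xinj; rewrite -aE.
(* Centrality is now used at [t]. The products [dx_i (x) dx_j] are central, so comparing
   coefficients gives [t a_ij = a_ij t]. *)
have : metric D (fun i j => t A * a i j) (fun=> t A * 0) (t A * 0) =
       metric D (fun i j => a i j * t A) (fun=> 0) 0.
  rewrite -(metricZ _ a (fun=> 0) 0) !metric_deg -gE g_central gE /g_deg.
  rewrite ract_suml; apply: eq_bigr => k _; rewrite ract_suml.
  by apply: eq_bigr => l _; rewrite ractZ -dx_dx_central scalerA.
by case/metric_inj.
Qed.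

End Spacetime.

Theorem proposition2p1 (R : realType) (n : nat) (lam : R[i])
    (hn : (2 < n)%N) (him : complex.Re lam = 0) (hlam : lam != 0)
    (A : spacetime n.-1 lam) (D : calculus A) (g : Om11 D) :
  (exists (a : 'I_n.-1 -> 'I_n.-1 -> A) (b : 'I_n.-1 -> A) (c : A),
    [/\ (forall i j, a i j = a j i) /\ g = metric D a b c,
        [/\ forall i j, null_mode_free (a i j),
            forall i, null_mode_free (b i)
          & null_mode_free c],
        quantum_symmetric g
      & central g])
  <->
  (exists a : 'I_n.-1 -> 'I_n.-1 -> A,
    [/\ forall i j, a i j = a j i,
        forall i j, scaling_degree0 (a i j)
      & g = g_deg D a]).
Proof.
have two0 : 2%:R != 0 :> R[i] by rewrite Num.Theory.pnatr_eq0.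
(* This provides two distinct variables. *)
have n1 : (1 < n.-1)%N by case: n hn {A D g} => [|[|[]]].
split=> [[a [b [c [[aS gE] [a_free _ _] _ g_central]]]]|[a [aS a0 ->]]].
  rewrite gE in g_central.
  have [gdeg a0] := central_metric_deg hlam two0 n1 a_free g_central.
  by exists a; rewrite gE gdeg.
exists a, (fun=> 0), 0; split.
- by rewrite metric_deg.
(* All coefficients are functions of [x] already, so invariance under the shift need not be
   invoked. *)
- split=> [i j _|i _|_].
  + by have [f [aE _]] := a0 i j; exists f.
  + by exists 0; rewrite rmorph0.
  + by exists 0; rewrite rmorph0.
- exact: g_deg_symmetric.
- exact: g_deg_central.
Qed.
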